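(* Let $(G,d)$ be a group with a two-sided invariant metric and $A\le G$ a closed subgroup. Let $\langle t\rangle\cong\mathbb Z$ with metric $d(t^m,t^n)=|m-n|$, and let $d$ also denote the Graev metric on the free product $G*\langle t\rangle$. The subgroup of $G*\langle t\rangle$ generated by $G$ and $tAt^{-1}$ is (as an abstract group) the free product $G*tAt^{-1}$; equip $tAt^{-1}$ with the metric $d(ta_1t^{-1},ta_2t^{-1})=d(a_1,a_2)$ and let $\underline d$ be the Graev metric on the free product $(G,d)*(tAt^{-1},d)$. Then $d|_{G*tAt^{-1}}=\underline d$ if and only if $\operatorname{diam}_d(A)\le 1$.
   Context: Graev metric on a free product (amalgamation over the trivial group): for groups $(H_1,d_1),(H_2,d_2)$ with two-sided invariant metrics, let $H=H_1\cup H_2$ (with $H_1\cap H_2=\{e\}$) carry the metric equal to $d_i$ on $H_i$ and $d(h_1,h_2)=d_1(h_1,e)+d_2(e,h_2)$ for $h_1\in H_1$, $h_2\in H_2$. For words $\alpha$ over the alphabet $H$, $\hat\alpha$ is the product of its letters in $H_1*H_2$. The Graev metric is $\underline d(f_1,f_2)=\inf\{\sum_i d(\alpha_1(i),\alpha_2(i)):|\alpha_1|=|\alpha_2|,\ \hat\alpha_1=f_1,\ \hat\alpha_2=f_2\}$, a two-sided invariant metric on $H_1*H_2$ extending $d_1,d_2$. $\operatorname{diam}_d(A)=\sup\{d(a_1,a_2):a_1,a_2\in A\}$. *)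

(* Defs.v *)
From Stdlib Require Import Reals Lra Lia ZArith List Classical ClassicalEpsilon ProofIrrelevance.
Import ListNotations.
Open Scope R_scope.
Set Implicit Arguments.

Record Grp := {
  car :> Type;
  gop : car -> car -> car;
  ginv : car -> car;
  gone : car;
  gopA : forall x y z, gop x (gop y z) = gop (gop x y) z;
  gop1x : forall x, gop gone x = x;
  gopx1 : forall x, gop x gone = x;
  gopVx : forall x, gop (ginv x) x = gone;
  gopxV : forall x, gop x (ginv x) = gone }.
Arguments gop {g}.
Arguments ginv {g}.
Arguments gone {g}.

Definition is_metric (X : Type) (d : X -> X -> R) : Prop :=
  (forall x y, d x y = 0 <-> x = y) /\
  (forall x y, d x y = d y x) /\
  (forall x y z, d x z <= d x y + d y z).

Definition two_sided_invariant (G : Grp) (d : G -> G -> R) : Prop :=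
  forall g x y, d (gop g x) (gop g y) = d x y /\ d (gop x g) (gop y g) = d x y.

Record is_subgroup (G : Grp) (A : G -> Prop) : Prop := {
  sg_one : A gone;
  sg_mul : forall x y, A x -> A y -> A (gop x y);
  sg_inv : forall x, A x -> A (ginv x) }.

Arguments is_subgroup {G}.
Arguments sg_mul {G A} _ {x y}.
Arguments sg_inv {G A} _ {x}.

Definition is_closed (G : Grp) (d : G -> G -> R) (A : G -> Prop) : Prop :=
  forall (x : nat -> G) (l : G),
    (forall n, A (x n)) -> Un_cv (fun n => d (x n) l) 0 -> A l.

Definition diam_le (G : Grp) (d : G -> G -> R) (A : G -> Prop) (c : R) : Prop :=
  forall a1 a2, A a1 -> A a2 -> d a1 a2 <= c.

Section Sub.
Variables (G : Grp) (A : G -> Prop) (HA : is_subgroup A).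
Definition subT := { x : G | A x }.
Definition sub_op (x y : subT) : subT :=
  exist _ (gop (proj1_sig x) (proj1_sig y)) (sg_mul HA (proj2_sig x) (proj2_sig y)).
Definition sub_inv (x : subT) : subT :=
  exist _ (ginv (proj1_sig x)) (sg_inv HA (proj2_sig x)).
Definition sub_one : subT := exist _ gone (sg_one HA).
Lemma sub_eq (x y : subT) : proj1_sig x = proj1_sig y -> x = y.
Proof. destruct x, y; simpl; intros ->; f_equal; apply proof_irrelevance. Qed.
Definition subgrp : Grp.
Proof.
  refine (@Build_Grp subT sub_op sub_inv sub_one _ _ _ _ _);
  intros; apply sub_eq; simpl.
  - apply gopA. - apply gop1x. - apply gopx1. - apply gopVx. - apply gopxV.
Defined.
End Sub.

(** The infinite cyclic group <t> = Z (t^n is represented by n) *)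
Definition Zgrp : Grp.
Proof.
  refine (@Build_Grp Z Z.add Z.opp 0%Z _ _ _ _ _); intros; lia.
Defined.
Definition dZ (m n : Zgrp) : R := Rabs (IZR (m - n)%Z).

Definition is_glb (S : R -> Prop) (r : R) : Prop :=
  (forall x, S x -> r <= x) /\ (forall r', (forall x, S x -> r' <= x) -> r' <= r).
Definition Rinf (S : R -> Prop) : R := epsilon (inhabits 0) (is_glb S).

(** * Free products H1 * H2 via normal forms.
   Letters of the alphabet H = H1 u H2 are elements of H1 + H2 (the two copies
   of the identity represent the same element e). A word is a list of letters;
   its value hat(alpha) in H1*H2 is its reduced (normal) form: a list of
   non-identity letters with alternating factors. *)
Section FreeProduct.
Variables (H1 H2 : Grp).
Definition letter := (H1 + H2)%type.
Definition word := list letter.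

Definition dec (P : Prop) : bool := if excluded_middle_informative P then true else false.

Definition push (x : letter) (w : word) : word :=
  match x with
  | inl a =>
      if dec (a = gone) then w else
      match w with
      | inl b :: w' => let c := gop a b in if dec (c = gone) then w' else inl c :: w'
      | _ => inl a :: w
      end
  | inr a =>
      if dec (a = gone) then w else
      match w with
      | inr b :: w' => let c := gop a b in if dec (c = gone) then w' else inr c :: w'
      | _ => inr a :: w
      end
  end.

Definition hat (alpha : word) : word := fold_right push [] alpha.

Variables (d1 : H1 -> H1 -> R) (d2 : H2 -> H2 -> R).

Definition ldist (x y : letter) : R :=
  match x, y with
  | inl a, inl b => d1 a b
  | inr a, inr b => d2 a b
  | inl a, inr b => d1 a gone + d2 gone b
  | inr a, inl b => d2 a gone + d1 gone b
  end.

Definition wcost (a1 a2 : word) : R :=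
  fold_right Rplus 0 (map (fun p => ldist (fst p) (snd p)) (combine a1 a2)).

Definition graev_set (u1 u2 : word) (r : R) : Prop :=
  exists a1 a2 : word, length a1 = length a2 /\ hat a1 = hat u1 /\ hat a2 = hat u2 /\
                       r = wcost a1 a2.

Definition graev (u1 u2 : word) : R := Rinf (graev_set u1 u2).
End FreeProduct.

(** The identification G * tAt^{-1} -> G * <t>: g |-> g, a |-> t a t^{-1}
   (extended letterwise to words). *)
Definition conj_emb (G : Grp) (A : G -> Prop) (HA : is_subgroup A)
  (x : letter G (subgrp HA)) : word G Zgrp :=
  match x with
  | inl g => [inl g]
  | inr a => [inr 1%Z; inl (proj1_sig a); inr (-1)%Z]
  end.

(** the metric on tAt^{-1}: d(t a1 t^-1, t a2 t^-1) = d(a1, a2) *)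
Definition dsub (G : Grp) (d : G -> G -> R) (A : G -> Prop) (HA : is_subgroup A)
  (a b : subgrp HA) : R := d (proj1_sig a) (proj1_sig b).

Arguments is_metric {X}.
Arguments two_sided_invariant {G}.
Arguments is_closed {G}.
Arguments diam_le {G}.
Arguments graev {H1 H2}.
Arguments graev_set {H1 H2}.
Arguments hat {H1 H2}.
Arguments conj_emb {G A}.
Arguments dsub {G} d {A HA}.

(* Main.v *)
(** For the forward direction, compare b and t b t^-1 with b in A. Graev distances
   dominate the sum of the distances between the projections to both factors,
   so in G * tAt^-1 the distance is at least 2 d(b,1); in G * <t> it is at
   most 2, by pairing 1 b 1 with t b t^-1.

   The converse needs a lower bound for the Graev norm on G * <t>. A word over
   G and t^{+-1} is filled by repeatedly removing a factor t^e y t^-e and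
   finally the whole remaining word, where the removal of y costs the number
   of letters t^{+-1} in y plus the distance from 1 of the product of the
   letters of G in y. The infimal cost of a filling is invariant under the
   relations of G * <t> and 1-Lipschitz in each letter, so it bounds the Graev
   norm from below. If a word runs alternately through letters of G at height 0
   and letters of A at height 1, with t and t^-1 moving between the heights,
   then all the factors y met in a filling are loops based at one of the two
   heights, and such a loop spells an element of G * tAt^-1. When
   diam A <= 1 the Graev norm of this element is at most the cost of y: with 2n
   letters t^{+-1} one may afford to change the at most n stretches at height
   1 twice, once in tAt^-1 and once in the product in G. *)
Require Import Defs.
From Stdlib Require Import Reals List.
From Stdlib Require Import Lra Lia ZArith ClassicalEpsilon.
Import ListNotations.
Open Scope R_scope.
Set Implicit Arguments.

Section GroupFacts.
Variable G : Grp.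
Implicit Types x y z : G.

Lemma gop_VK x y : gop (ginv x) (gop x y) = y.
Proof. now rewrite gopA, gopVx, gop1x. Qed.

Lemma gop_inv_l x y : gop x y = gone -> y = ginv x.
Proof. intros E; rewrite <- (gop_VK x y), E; apply gopx1. Qed.

Lemma gop_cancel_l x y z : gop x y = gop x z -> y = z.
Proof. intros E; rewrite <- (gop_VK x y), E; apply gop_VK. Qed.
End GroupFacts.

Lemma decP (P : Prop) : (P /\ dec P = true) \/ (~ P /\ dec P = false).
Proof. unfold dec; destruct excluded_middle_informative; auto. Qed.

Lemma dec_true (P : Prop) : P -> dec P = true.
Proof. destruct (decP P); tauto. Qed.

Ltac case_dec :=
  match goal with |- context [dec ?P] =>
    let H := fresh "Hd" in
    destruct (decP P) as [[H ->]|[H ->]] end.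

(** * Reduced words and the defining relations of a free product *)

Section NormalForms.
Variables H1 H2 : Grp.
Notation letter := (letter H1 H2).
Notation word := (word H1 H2).

Definition nonid (x : letter) : Prop :=
  match x with inl a => a <> gone | inr a => a <> gone end.

Definition clash (x : letter) (w : word) : Prop :=
  match x, w with
  | inl _, inl _ :: _ => True
  | inr _, inr _ :: _ => True
  | _, _ => False
  end.

Fixpoint red (w : word) : Prop :=
  match w with [] => True | x :: w' => nonid x /\ ~ clash x w' /\ red w' end.

Lemma red_push x w : red w -> red (push x w).
Proof.
  intros R; destruct x as [a|a]; destruct w as [|[b|b] w]; simpl in *;
    repeat (case_dec; simpl); intuition;
    destruct w as [|[c|c] w]; simpl in *; tauto.
Qed.

Lemma red_fold u w : red w -> red (fold_right (@push _ _) w u).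
Proof. intros R; induction u; simpl; auto using red_push. Qed.

Lemma red_hat u : red (hat u).
Proof. now apply red_fold. Qed.

Ltac grp :=
  repeat match goal with
  | H : gop ?x ?y = gone |- _ => apply gop_inv_l in H; subst
  end;
  repeat (rewrite ?gop1x, ?gopx1, ?gopVx, ?gopxV, ?gop_VK, <- ?gopA in * ); try tauto; try congruence.

Ltac merge_letters a b w R :=
  let Ha := fresh in let Hb := fresh in
  destruct (decP (a = gone)) as [[-> _]|[Ha _]];
  [rewrite gop1x; simpl; now rewrite dec_true|];
  destruct (decP (b = gone)) as [[-> _]|[Hb _]];
  [rewrite gopx1; simpl; now rewrite (dec_true (P := gone = gone))|];
  destruct w as [|[c|c] w]; simpl in R |- *;
  try solve [repeat (case_dec; simpl); grp];
  destruct R as (Hc & Hcl & _);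
  destruct (decP (b = gone)) as [[? _]|[_ ->]]; [tauto|];
  destruct (decP (gop b c = gone)) as [[E ->]|[E ->]]; simpl;
  [ apply gop_inv_l in E; subst c;
    destruct (decP (a = gone)) as [[? _]|[_ ->]]; [tauto|];
    destruct (decP (gop a b = gone)) as [[E' ->]|[E' ->]];
    [ apply gop_inv_l in E'; subst b;
      destruct w as [|[c|c] w]; simpl in Hcl; try tauto; do 2 f_equal;
      apply (@gop_cancel_l _ (ginv a)); now rewrite gopVx, gopxV
    | rewrite <- gopA, gopxV, gopx1;
      destruct (decP (a = gone)) as [[? _]|[_ ->]]; [tauto|];
      destruct w as [|[d|d] w]; simpl in Hcl; tauto ]
  | destruct (decP (a = gone)) as [[? _]|[_ ->]]; [tauto|];
    rewrite gopA;
    destruct (decP (gop a b = gone)) as [[E' ->]|[E' ->]]; simpl; trivial;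
    rewrite E', gop1x; case_dec; tauto ].

(** If [b] cancels the head of [w], then [a] is pushed onto the tail; since [w] is reduced, the tail
    does not start in the same factor, so [a] is not merged any further. *)
Lemma push_inl a b w : red w -> push (inl a) (push (inl b) w) = push (inl (gop a b)) w.
Proof. intros R; merge_letters a b w R. Qed.

Lemma push_inr a b w : red w -> push (inr a) (push (inr b) w) = push (inr (gop a b)) w.
Proof. intros R; merge_letters a b w R. Qed.

Lemma push_one_l w : push (inl gone) w = w :> word.
Proof. simpl; now rewrite dec_true. Qed.
Lemma push_one_r w : push (inr gone) w = w :> word.
Proof. simpl; now rewrite dec_true. Qed.

Definition heq (u v : word) : Prop := hat u = hat v.

Lemma heq_inl a b w : heq (inl a :: inl b :: w) (inl (gop a b) :: w).
Proof. apply push_inl, red_hat. Qed.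
Lemma heq_inr a b w : heq (inr a :: inr b :: w) (inr (gop a b) :: w).
Proof. apply push_inr, red_hat. Qed.
Lemma heq_one_l w : heq (inl gone :: w) w.
Proof. apply push_one_l. Qed.
Lemma heq_one_r w : heq (inr gone :: w) w.
Proof. apply push_one_r. Qed.
End NormalForms.

(* The push of a letter is obtained by merging or deleting letters, so an
   invariant of these moves is an invariant of the normal form. *)
Lemma hat_invariant (H1 H2 : Grp) (E : word H1 H2 -> word H1 H2 -> Prop) :
  (forall u, E u u) -> (forall u v w, E u v -> E v w -> E u w) ->
  (forall x u v, E u v -> E (x :: u) (x :: v)) ->
  (forall w, E (inl gone :: w) w) -> (forall w, E (inr gone :: w) w) ->
  (forall a b w, E (inl a :: inl b :: w) (inl (gop a b) :: w)) ->
  (forall a b w, E (inr a :: inr b :: w) (inr (gop a b) :: w)) ->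
  forall u, E u (hat u).
Proof.
  intros rfl tr cns one_l one_r mul_l mul_r u; induction u as [|x u IH]; [apply rfl|].
  apply tr with (x :: hat u); [now apply cns|]; clear IH.
  simpl; generalize (hat u) as w; intros w.
  destruct x as [a|a]; simpl; case_dec; subst; auto;
    destruct w as [|[b|b] w]; auto;
    case_dec; auto; (eapply tr; [first [apply mul_l | apply mul_r]|rewrite Hd0; auto]).
Qed.

(** * Equality in the free product as a congruence, and inverses *)

Section Words.
Variables H1 H2 : Grp.
Notation letter := (letter H1 H2).
Notation word := (word H1 H2).
Implicit Types u v w : word.

Lemma hat_app u v : hat (u ++ v) = fold_right (@push _ _) (hat v) u.
Proof. apply fold_right_app. Qed.

(** Every merging or deleting move inside [u] is also such a move inside [u ++ v]. This makes [heq]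
    a congruence in its left argument. *)
Lemma heq_app_hat u v : heq (u ++ v) (hat u ++ v).
Proof.
  apply (@hat_invariant H1 H2 (fun u u' => heq (u ++ v) (u' ++ v))); unfold heq.
  - reflexivity.
  - intros; congruence.
  - intros x a b E; simpl; now rewrite E.
  - intros; apply heq_one_l.
  - intros; apply heq_one_r.
  - intros; apply heq_inl.
  - intros; apply heq_inr.
Qed.

Lemma heq_app u u' v v' : heq u u' -> heq v v' -> heq (u ++ v) (u' ++ v').
Proof.
  unfold heq; intros Eu Ev.
  rewrite (heq_app_hat u), (heq_app_hat u'), Eu, !hat_app; now rewrite Ev.
Qed.

Lemma heq_cons x v v' : heq v v' -> heq (x :: v) (x :: v').
Proof. apply (@heq_app [x] [x]); reflexivity. Qed.

Definition linv (x : letter) : letter :=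
  match x with inl a => inl (ginv a) | inr a => inr (ginv a) end.
Definition winv (w : word) : word := rev (map linv w).

Lemma heq_linv_r x w : heq (x :: linv x :: w) w.
Proof.
  destruct x; simpl; [eapply eq_trans; [apply heq_inl|]|eapply eq_trans; [apply heq_inr|]];
    rewrite gopxV; [apply heq_one_l|apply heq_one_r].
Qed.

Lemma heq_linv_l x w : heq (linv x :: x :: w) w.
Proof.
  destruct x; simpl; [eapply eq_trans; [apply heq_inl|]|eapply eq_trans; [apply heq_inr|]];
    rewrite gopVx; [apply heq_one_l|apply heq_one_r].
Qed.

Lemma heq_winv_r w : heq (w ++ winv w) [].
Proof.
  unfold winv; induction w as [|x w IH]; [reflexivity|].
  simpl; rewrite app_assoc.
  apply eq_trans with (hat ([x] ++ [linv x])); [|apply heq_linv_r].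
  apply heq_cons, (@heq_app _ [] _ [linv x]); [exact IH|reflexivity].
Qed.

Lemma heq_winv_l w : heq (winv w ++ w) [].
Proof.
  unfold winv; induction w as [|x w IH]; [reflexivity|].
  simpl; rewrite <- app_assoc; simpl.
  eapply eq_trans; [|exact IH].
  apply heq_app; [reflexivity|apply heq_linv_l].
Qed.
End Words.

(** * Metrics, two-sided invariance and the metric on the integers *)

Section Metric.
Variables (X : Type) (d : X -> X -> R).
Hypothesis Hd : is_metric d.

Lemma dist_refl x : d x x = 0.
Proof. now apply Hd. Qed.
Lemma dist_sym x y : d x y = d y x.
Proof. apply Hd. Qed.
Lemma dist_tri x y z : d x z <= d x y + d y z.
Proof. apply Hd. Qed.
Lemma dist_nonneg x y : 0 <= d x y.
Proof. generalize (dist_tri x y x); rewrite (dist_sym y x), dist_refl; lra. Qed.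
End Metric.

Section Norm.
Variables (G : Grp) (d : G -> G -> R).
Hypothesis Hd : is_metric d.
Hypothesis Hinv : two_sided_invariant d.

Lemma dist_mul_l g x y : d (gop g x) (gop g y) = d x y.
Proof. apply Hinv. Qed.
Lemma dist_mul_r g x y : d (gop x g) (gop y g) = d x y.
Proof. apply Hinv. Qed.
Lemma dist_mul x x' y y' : d (gop x y) (gop x' y') <= d x x' + d y y'.
Proof.
  generalize (dist_tri Hd (gop x y) (gop x' y) (gop x' y')).
  rewrite dist_mul_l, dist_mul_r; lra.
Qed.
Lemma dist_mul_one_l a x : d (gop a x) x = d a gone.
Proof. rewrite <- (gop1x _ x) at 2; apply dist_mul_r. Qed.
End Norm.

Lemma dZ_metric : is_metric dZ.
Proof.
  unfold dZ; split; [|split].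
  - intros x y; split; intros E.
    + destruct (Z.eq_dec (x - y) 0) as [|N]; [lia|].
      apply eq_IZR_contrapositive, Rabs_no_R0 in N; tauto.
    + rewrite E, Z.sub_diag; apply Rabs_R0.
  - intros x y; rewrite !minus_IZR; apply Rabs_minus_sym.
  - intros x y z; replace (x - z)%Z with ((x - y) + (y - z))%Z by lia.
    rewrite (plus_IZR (x - y)); apply Rabs_triang.
Qed.

(** * Calculus of upper bounds for the Graev metric *)

Section GraevBound.
Variables (H1 H2 : Grp) (d1 : H1 -> H1 -> R) (d2 : H2 -> H2 -> R).
Hypotheses (M1 : is_metric d1) (M2 : is_metric d2).
Notation letter := (letter H1 H2).
Notation word := (word H1 H2).
Implicit Types u v w : word.

Lemma ldist_nonneg x y : 0 <= ldist d1 d2 x y.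
Proof.
  generalize (dist_nonneg M1) (dist_nonneg M2); intros P1 P2.
  destruct x, y; simpl; auto; apply Rplus_le_le_0_compat; auto.
Qed.

Lemma wcost_nonneg u v : 0 <= wcost d1 d2 u v.
Proof.
  unfold wcost; induction (combine u v); simpl; [lra|].
  apply Rplus_le_le_0_compat; auto using ldist_nonneg.
Qed.

Lemma wcost_refl u : wcost d1 d2 u u = 0.
Proof.
  unfold wcost; induction u as [|[x|x] u IH]; simpl in *; trivial; rewrite IH, dist_refl; auto; lra.
Qed.

Lemma wcost_sym u v : wcost d1 d2 u v = wcost d1 d2 v u.
Proof.
  unfold wcost; revert v; induction u as [|x u IH]; intros [|y v]; simpl; trivial.
  rewrite IH; f_equal; destruct x as [a|a], y as [b|b]; simpl.
  - now apply dist_sym.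
  - rewrite (dist_sym M1 a), (dist_sym M2 gone); apply Rplus_comm.
  - rewrite (dist_sym M2 a), (dist_sym M1 gone); apply Rplus_comm.
  - now apply dist_sym.
Qed.

Lemma wcost_app u u' v v' : length u = length u' ->
  wcost d1 d2 (u ++ v) (u' ++ v') = wcost d1 d2 u u' + wcost d1 d2 v v'.
Proof.
  unfold wcost; revert u'; induction u as [|x u IH]; intros [|x' u']; simpl; try discriminate.
  - intros; lra.
  - intros E; injection E as E; rewrite IH; trivial; lra.
Qed.

(** Bounds are witnessed by an actual pair of words, so they can be concatenated and chained without
    handling infima; [graev_le] returns to the infimum at the end. *)
Definition gle (u v : word) (r : R) : Prop := exists2 s, graev_set d1 d2 u v s & s <= r.

Lemma gle_weaken u v r s : gle u v r -> r <= s -> gle u v s.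
Proof. intros [x ? ?] ?; exists x; trivial; lra. Qed.

Lemma gle_heq u v : heq u v -> gle u v 0.
Proof.
  intros E; exists 0; [|lra]; exists u, u; repeat split; trivial.
  now rewrite wcost_refl.
Qed.

Lemma gle_app u u' v v' r s : gle u u' r -> gle v v' s -> gle (u ++ v) (u' ++ v') (r + s).
Proof.
  intros [r' (a & a' & La & Ea & Ea' & ->) Hr] [s' (b & b' & Lb & Eb & Eb' & ->) Hs].
  eexists; [exists (a ++ b), (a' ++ b'); repeat split|].
  - rewrite !length_app; congruence.
  - now apply heq_app.
  - now apply heq_app.
  - rewrite wcost_app; trivial; lra.
Qed.

Lemma gle_app_l u v v' r : gle v v' r -> gle (u ++ v) (u ++ v') r.
Proof. intros L; rewrite <- (Rplus_0_l r); apply gle_app; trivial; now apply gle_heq. Qed.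

Lemma gle_app_r u u' v r : gle u u' r -> gle (u ++ v) (u' ++ v) r.
Proof. intros L; rewrite <- (Rplus_0_r r); apply gle_app; trivial; now apply gle_heq. Qed.

Lemma gle_letter x y : gle [x] [y] (ldist d1 d2 x y).
Proof. exists (wcost d1 d2 [x] [y]); [now exists [x], [y]|unfold wcost; simpl; lra]. Qed.

(* Pair a b^-1 b with a' b^-1 b', where a' and b spell the same element. *)
Lemma gle_trans u v w r s : gle u v r -> gle v w s -> gle u w (r + s).
Proof.
  intros [r' (a & a' & La & Ea & Ea' & ->) Hr] [s' (b & b' & Lb & Eb & Eb' & ->) Hs].
  eexists; [exists (a ++ (winv b ++ b)), ((a' ++ winv b) ++ b'); repeat split|].
  - rewrite !length_app; lia.
  - eapply eq_trans; [|exact Ea].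
    rewrite <- (app_nil_r a) at 2; apply heq_app; [reflexivity|apply heq_winv_l].
  - eapply eq_trans; [|exact Eb'].
    apply (@heq_app _ _ _ [] b' b'); [|reflexivity].
    eapply eq_trans; [apply heq_app with (u' := b); [congruence|reflexivity]|apply heq_winv_r].
  - rewrite <- app_assoc, !wcost_app, wcost_refl; trivial; lra.
Qed.
End GraevBound.

(** * The Graev metric as a genuine infimum *)

Lemma Rinf_glb (S : R -> Prop) : (exists x, S x) -> (forall x, S x -> 0 <= x) -> is_glb S (Rinf S).
Proof.
  intros [x0 Hx0] Hpos; unfold Rinf; apply epsilon_spec.
  destruct (completeness (fun y => S (- y))) as [m [Hub Hlub]].
  - exists 0; intros y Hy; generalize (Hpos _ Hy); lra.
  - exists (- x0); now rewrite Ropp_involutive.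
  - exists (- m); split.
    + intros x Hx. cut (- x <= m); [lra|]; apply Hub; now rewrite Ropp_involutive.
    + intros r' Hr'; cut (m <= - r'); [lra|]; apply Hlub; intros y Hy.
      generalize (Hr' _ Hy); lra.
Qed.

Lemma graev_glb (H1 H2 : Grp) (d1 : H1 -> H1 -> R) (d2 : H2 -> H2 -> R) u v :
  is_metric d1 -> is_metric d2 -> is_glb (graev_set d1 d2 u v) (graev d1 d2 u v).
Proof.
  intros M1 M2; apply Rinf_glb.
  (* Padding [u] on the right and [v] on the left with trivial letters gives words of equal length,
     so the set of costs is nonempty. *)
  - set (z := fun _ : letter H1 H2 => inl gone : letter H1 H2).
    assert (E : forall w, heq (map z w) []).
    { induction w; [reflexivity|]. eapply eq_trans; [apply heq_one_l|trivial]. }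
    eexists; exists (u ++ map z v), (map z u ++ v).
    repeat split.
    + now rewrite !length_app, !length_map.
    + rewrite <- (app_nil_r u) at 2; apply heq_app; [reflexivity|apply E].
    + apply (@heq_app _ _ _ [] v v); [apply E|reflexivity].
  - intros x (a & b & _ & _ & _ & ->); now apply wcost_nonneg.
Qed.

(** * Lower bound by the projections to the factors *)

Section Projections.
Variables (H1 H2 : Grp) (d1 : H1 -> H1 -> R) (d2 : H2 -> H2 -> R).
Hypotheses (M1 : is_metric d1) (M2 : is_metric d2).
Hypotheses (I1 : two_sided_invariant d1) (I2 : two_sided_invariant d2).

Definition left_part (x : letter H1 H2) : H1 := match x with inl a => a | inr _ => gone end.
Definition right_part (x : letter H1 H2) : H2 := match x with inl _ => gone | inr a => a end.
Definition left_prod (w : word H1 H2) : H1 := fold_right (fun x p => gop (left_part x) p) gone w.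
Definition right_prod (w : word H1 H2) : H2 := fold_right (fun x p => gop (right_part x) p) gone w.

Lemma left_prod_hat u : left_prod u = left_prod (hat u).
Proof.
  apply (@hat_invariant H1 H2 (fun u v => left_prod u = left_prod v)); simpl; intros;
    rewrite ?gop1x, ?gopA; congruence.
Qed.

Lemma right_prod_hat u : right_prod u = right_prod (hat u).
Proof.
  apply (@hat_invariant H1 H2 (fun u v => right_prod u = right_prod v)); simpl; intros;
    rewrite ?gop1x, ?gopA; congruence.
Qed.

(** The distance of two letters is exactly the sum of the distances of their projections, and by
    two-sided invariance the distance of two products is at most the sum over the factors. *)
Lemma wcost_ge_prod a b : length a = length b ->
  d1 (left_prod a) (left_prod b) + d2 (right_prod a) (right_prod b) <= wcost d1 d2 a b.
Proof.
  unfold wcost, left_prod, right_prod; revert b.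
  induction a as [|x a IH]; intros [|y b]; try discriminate.
  - intros _; simpl; rewrite (dist_refl M1), (dist_refl M2); lra.
  - intros E; injection E as E; apply IH in E; simpl.
    generalize (dist_mul M1 I1 (left_part x) (left_part y) (left_prod a) (left_prod b)).
    generalize (dist_mul M2 I2 (right_part x) (right_part y) (right_prod a) (right_prod b)).
    assert (ldist d1 d2 x y = d1 (left_part x) (left_part y) + d2 (right_part x) (right_part y)).
    { destruct x, y; simpl; rewrite ?(dist_refl M1), ?(dist_refl M2); lra. }
    unfold left_prod, right_prod; lra.
Qed.

Lemma graev_ge_prod u v :
  d1 (left_prod u) (left_prod v) + d2 (right_prod u) (right_prod v) <= graev d1 d2 u v.
Proof.
  apply graev_glb; trivial; intros x (a & b & L & Ea & Eb & ->).
  rewrite (left_prod_hat u), (left_prod_hat v), (right_prod_hat u), (right_prod_hat v), <- Ea, <- Eb.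
  rewrite <- !left_prod_hat, <- !right_prod_hat; now apply wcost_ge_prod.
Qed.
End Projections.

(** * Fillings of words over G and t, and their stability *)

Section Filling.
Variables (G : Grp) (d : G -> G -> R).
Hypotheses (Hd : is_metric d) (Hinv : two_sided_invariant d).

(* Words over G and t^{+-1}, where [inr true] is t and [inr false] is t^-1. *)
Definition tword := list (G + bool).
Implicit Types w z : tword.

Definition gprod w : G :=
  fold_right (fun a p => match a with inl g => gop g p | inr _ => p end) gone w.
Definition tcount w : R :=
  fold_right (fun a n => match a with inl _ => n | inr _ => 1 + n end) 0 w.
Definition defect w : R := tcount w + d (gprod w) gone.

Lemma gprod_app u v : gprod (u ++ v) = gop (gprod u) (gprod v).
Proof.
  induction u as [|[g|b] u IH]; simpl; rewrite ?gop1x, ?IH; trivial. now rewrite gopA.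
Qed.

Lemma tcount_app u v : tcount (u ++ v) = tcount u + tcount v.
Proof. induction u as [|[g|b] u IH]; simpl; lra. Qed.

Lemma defect_nil : defect [] = 0.
Proof. unfold defect; simpl; rewrite dist_refl; trivial; lra. Qed.

Lemma defect_replace x y z z' :
  defect (x ++ z' ++ y) <= defect (x ++ z ++ y) + (tcount z' - tcount z + d (gprod z) (gprod z')).
Proof.
  unfold defect; rewrite !tcount_app, !gprod_app.
  generalize (dist_tri Hd (gop (gprod x) (gop (gprod z') (gprod y)))
                (gop (gprod x) (gop (gprod z) (gprod y))) gone).
  rewrite dist_mul_l, dist_mul_r, (dist_sym Hd (gprod z')); trivial; lra.
Qed.

(** The real number is an upper bound for the cost, so the relation is upward closed. The removed
    [y] may itself contain letters [t^{+-1}], which [defect y] charges at 1 each. *)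
Inductive fill : tword -> R -> Prop :=
| fill_flat w r : defect w <= r -> fill w r
| fill_pair e v1 y v2 r s : fill (v1 ++ v2) r -> r + defect y <= s ->
    fill (v1 ++ inr e :: y ++ inr (negb e) :: v2) s.

Lemma fill_weaken w r s : fill w r -> r <= s -> fill w s.
Proof.
  destruct 1; intros; [apply fill_flat|eapply fill_pair; eauto]; lra.
Qed.

Definition tfree z : Prop := forall b, ~ In (inr b) z.

Lemma tfree_split w1 z w2 v1 e v2 : tfree z -> w1 ++ z ++ w2 = v1 ++ inr e :: v2 ->
  (exists l, v1 = w1 ++ z ++ l /\ w2 = l ++ inr e :: v2) \/
  (exists l, w1 = v1 ++ inr e :: l /\ v2 = l ++ z ++ w2).
Proof.
  intros F; revert v1; induction w1 as [|a w1 IH]; simpl.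
  - intros v1 E; left; revert v1 E; induction z as [|a z IH]; simpl.
    + intros v1 E; now exists v1.
    + intros [|c v1] E; injection E as -> E.
      * destruct (F e); now left.
      * destruct (IH (fun b H => F b (or_intror H)) _ E) as (l & -> & ->); now exists l.
  - intros [|c v1] E; simpl in E; injection E as -> E.
    + right; now exists w1.
    + destruct (IH _ E) as [(l & -> & ->)|(l & -> & ->)]; [left|right]; now exists l.
Qed.

Lemma letter_split w1 (b : bool) w2 v1 (e : bool) v2 :
  w1 ++ inr b :: w2 = v1 ++ inr e :: v2 :> tword ->
  (exists l, v1 = w1 ++ inr b :: l /\ w2 = l ++ inr e :: v2) \/
  (w1 = v1 /\ b = e /\ w2 = v2) \/
  (exists l, w1 = v1 ++ inr e :: l /\ v2 = l ++ inr b :: w2).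
Proof.
  revert v1; induction w1 as [|a w1 IH]; intros [|c v1] E; simpl in E; injection E as -> E.
  - right; left; auto.
  - left; now exists v1.
  - right; right; now exists w1.
  - destruct (IH _ E) as [(l & -> & ->)|[(-> & -> & ->)|(l & -> & ->)]];
      [left|right; left|right; right]; auto; now exists l.
Qed.

Ltac flat := repeat (rewrite <- ?app_assoc in *; simpl in * ).

(** Being free of t, the block [z] lies entirely in [v1], [y] or [v2]. The change is therefore
    charged once, to a single defect. The new block [z'] may contain t, as insertion requires. *)
Lemma fill_edit z z' c w r : tfree z ->
  (forall x y, defect (x ++ z' ++ y) <= defect (x ++ z ++ y) + c) ->
  fill w r -> forall w1 w2, w = w1 ++ z ++ w2 -> fill (w1 ++ z' ++ w2) (r + c).
Proof.
  intros F Hc; induction 1 as [w r H|e v1 y v2 r s H IH Hs]; intros w1 w2 E.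
  - subst; apply fill_flat; generalize (Hc w1 w2); lra.
  - apply eq_sym, tfree_split in E as [(l & -> & ->)|(l & -> & E)]; trivial.
    + generalize (IH w1 (l ++ v2)); flat; intros K.
      rewrite app_assoc, (app_assoc _ l); apply fill_pair with (r + c); [|lra].
      rewrite <- !app_assoc; now apply K.
    + apply eq_sym, tfree_split in E as [(m & -> & ->)|(m & -> & ->)]; trivial; flat.
      * generalize (@fill_pair e v1 (l ++ z' ++ m) v2 r (s + c) H); flat.
        intros K; apply K; generalize (Hc l m); lra.
      * apply fill_pair with (r + c); [|lra].
        generalize (IH (v1 ++ m) w2); flat; auto.
Qed.

Lemma fill_insert w1 z w2 r s : fill (w1 ++ w2) r -> r + defect z <= s -> fill (w1 ++ z ++ w2) s.
Proof.
  intros H Hs; apply fill_weaken with (r + defect z); trivial.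
  apply (@fill_edit [] z (defect z)) with (w1 ++ w2); auto.
  - intros b [].
  - intros x y; generalize (defect_replace x y [] z).
    change (defect z) with (tcount z + d (gprod z) gone); simpl; rewrite (dist_sym Hd gone); lra.
Qed.

(** If the deleted letter belongs to a removed pair, its partner is joined to the contents [y] and
    the result is inserted into the rest; the partner raises the defect by 1. Otherwise the letter
    lies in [v1], [y] or [v2]. *)
Lemma fill_delete w r : fill w r ->
  forall w1 b w2, w = w1 ++ inr b :: w2 -> fill (w1 ++ w2) (r + 1).
Proof.
  induction 1 as [w r H|e v1 y v2 r s H IH Hs]; intros w1 b w2 E.
  - subst; apply fill_flat; revert H; unfold defect.
    rewrite !gprod_app, !tcount_app; simpl; lra.
  - apply eq_sym, letter_split in E as [(l & -> & ->)|[(-> & -> & ->)|(l & -> & E)]].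
    + rewrite app_assoc; apply fill_pair with (r + 1); [|lra].
      rewrite <- app_assoc; apply IH with b; flat; trivial.
    + generalize (@fill_insert v1 (y ++ [inr (negb e)]) v2 r (s + 1) H); flat.
      intros K; apply K; revert Hs; unfold defect; rewrite tcount_app, gprod_app; simpl.
      rewrite gopx1; lra.
    + apply eq_sym, letter_split in E as [(m & -> & ->)|[(-> & -> & ->)|(m & -> & ->)]]; flat.
      * generalize (@fill_pair e v1 (l ++ m) v2 r (s + 1) H); flat; intros K; apply K.
        revert Hs; unfold defect; rewrite !tcount_app, !gprod_app; simpl; lra.
      * generalize (@fill_insert v1 (inr e :: y) v2 r (s + 1) H); flat.
        intros K; apply K; revert Hs; unfold defect; simpl; lra.
      * apply fill_pair with (r + 1); [|lra].
        generalize (IH (v1 ++ m) b w2); flat; auto.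
Qed.

(* When one letter of the cancelled pair is matched with a letter of the
   filling, the other one takes its place or the contents are inserted outside. *)
Lemma fill_cancel w r : fill w r ->
  forall w1 b w2, w = w1 ++ inr b :: inr (negb b) :: w2 -> fill (w1 ++ w2) r.
Proof.
  induction 1 as [w r H|e v1 y v2 r s H IH Hs]; intros w1 b w2 E.
  - subst; apply fill_flat; revert H; unfold defect.
    rewrite !gprod_app, !tcount_app; simpl; lra.
  - apply eq_sym, letter_split in E as [(l & -> & E)|[(-> & -> & E)|(l & -> & E)]].
    + destruct l as [|c l]; simpl in E; injection E as <- ->; flat.
      * generalize (@fill_insert w1 y (inr b :: v2) r s); flat.
        rewrite Bool.negb_involutive; auto.
      * rewrite app_assoc; apply fill_pair with r; [|lra].
        rewrite <- app_assoc; apply IH with b; flat; trivial.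
    + destruct y as [|c y]; simpl in E.
      * injection E as ->; apply fill_weaken with r; trivial.
        rewrite defect_nil in Hs; lra.
      * injection E as <- ->.
        generalize (@fill_insert v1 (y ++ [inr (negb e)]) v2 r s H); flat.
        intros K; apply K; revert Hs; unfold defect; rewrite tcount_app, gprod_app; simpl.
        rewrite gopx1; lra.
    + apply eq_sym, letter_split in E as [(m & -> & E)|[(-> & -> & E)|(m & -> & ->)]].
      * destruct m as [|c m]; simpl in E; injection E as Ec ->; flat.
        -- assert (b = e) as -> by (destruct b, e; simpl in *; congruence).
           generalize (@fill_insert v1 (inr e :: l) v2 r s H); flat.
           intros K; apply K; revert Hs; unfold defect; rewrite tcount_app, gprod_app; simpl.
           rewrite gopx1; lra.
        -- subst c; generalize (@fill_pair e v1 (l ++ m) v2 r s H); flat; intros K; apply K.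
           revert Hs; unfold defect; rewrite !tcount_app, !gprod_app; simpl; lra.
      * subst; rewrite Bool.negb_involutive in *.
        generalize (@fill_insert (v1 ++ [inr e]) y w2 r s); flat; auto.
      * flat; apply fill_pair with r; [|lra].
        generalize (IH (v1 ++ m) b w2); flat; auto.
Qed.

(** * Change of the filling cost under replacement of a subword *)

(** The surrounding words are quantified so that the relation is compatible with concatenation;
    [teq] then expresses invariance of the infimal filling cost under a relation of the group. *)
Definition tlip u v (c : R) : Prop :=
  forall w1 w2 r, fill (w1 ++ u ++ w2) r -> fill (w1 ++ v ++ w2) (r + c).
Definition teq u v : Prop := tlip u v 0 /\ tlip v u 0.

Lemma tlip_trans u v w a b : tlip u v a -> tlip v w b -> tlip u w (a + b).
Proof. intros A B w1 w2 r H; rewrite <- Rplus_assoc; auto. Qed.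

Lemma tlip_weaken u v a b : tlip u v a -> a <= b -> tlip u v b.
Proof. intros A L w1 w2 r H; apply fill_weaken with (r + a); auto; lra. Qed.

Lemma tlip_refl u : tlip u u 0.
Proof. intros w1 w2 r H; now rewrite Rplus_0_r. Qed.

Lemma tlip_ctx x u v y a : tlip u v a -> tlip (x ++ u ++ y) (x ++ v ++ y) a.
Proof.
  intros A w1 w2 r H; generalize (A (w1 ++ x) (y ++ w2) r).
  rewrite <- !app_assoc in *; auto.
Qed.

Lemma tlip_app u u' v v' a b : tlip u u' a -> tlip v v' b -> tlip (u ++ v) (u' ++ v') (a + b).
Proof.
  intros A B; apply tlip_trans with (u' ++ v).
  - apply (tlip_ctx [] v A).
  - generalize (tlip_ctx u' [] B); now rewrite !app_nil_r.
Qed.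

Lemma teq_refl u : teq u u.
Proof. split; apply tlip_refl. Qed.
Lemma teq_sym u v : teq u v -> teq v u.
Proof. intros [? ?]; now split. Qed.
Lemma teq_trans u v w : teq u v -> teq v w -> teq u w.
Proof.
  intros [A A'] [B B']; split; rewrite <- (Rplus_0_l 0); eapply tlip_trans; eauto.
Qed.
Lemma teq_app u u' v v' : teq u u' -> teq v v' -> teq (u ++ v) (u' ++ v').
Proof.
  intros [A A'] [B B']; split; rewrite <- (Rplus_0_l 0); now apply tlip_app.
Qed.

Lemma tlip_gword z z' : tfree z -> tfree z' -> tlip z z' (d (gprod z) (gprod z')).
Proof.
  assert (T : forall z, tfree z -> tcount z = 0).
  { intros w; induction w as [|[g|b] w IH]; intros F; simpl; trivial.
    - apply IH; intros b H; apply (F b); now right.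
    - destruct (F b); now left. }
  intros F F' w1 w2 r H; apply (@fill_edit z) with (w1 ++ z ++ w2); trivial.
  intros x y; generalize (defect_replace x y z z'); rewrite (T z), (T z'); trivial; lra.
Qed.

Lemma tfree_nil : tfree [].
Proof. intros b []. Qed.
Lemma tfree_cons g z : tfree z -> tfree (inl g :: z).
Proof. intros F b [E|H]; [discriminate|now apply (F b)]. Qed.
Hint Resolve tfree_nil tfree_cons : core.

Lemma teq_gword z z' : tfree z -> tfree z' -> gprod z = gprod z' -> teq z z'.
Proof.
  intros F F' E; split; [generalize (tlip_gword F F')|generalize (tlip_gword F' F)];
    rewrite E, dist_refl; auto.
Qed.

(** Cancelling the pair is [fill_cancel]; creating it adds a removed pair with empty contents, of
    defect 0. *)
Lemma teq_cancel b : teq [inr b; inr (negb b)] [].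
Proof.
  split; intros w1 w2 r H; rewrite Rplus_0_r; simpl in *.
  - eapply fill_cancel; eauto.
  - apply (@fill_pair b w1 [] w2 r r H); rewrite defect_nil; lra.
Qed.

(** * Powers of t spelled out in single letters *)

Definition tpow (n : Z) : tword := repeat (inr (0 <=? n)%Z) (Z.abs_nat n).

Lemma tpow_succ_pos n : (0 <= n)%Z -> tpow (Z.succ n) = inr true :: tpow n.
Proof.
  intros L; unfold tpow; rewrite (proj2 (Z.leb_le 0 (Z.succ n))), (proj2 (Z.leb_le 0 n)) by lia.
  now replace (Z.abs_nat (Z.succ n)) with (S (Z.abs_nat n)) by lia.
Qed.

Lemma tpow_neg n : (n < 0)%Z -> tpow n = inr false :: tpow (Z.succ n).
Proof.
  intros L; unfold tpow; rewrite (proj2 (Z.leb_gt 0 n)) by lia.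
  replace (Z.abs_nat n) with (S (Z.abs_nat (Z.succ n))) by lia; simpl; f_equal.
  destruct (Z.eq_dec n (-1)) as [->|]; [reflexivity|].
  now rewrite (proj2 (Z.leb_gt 0 (Z.succ n))) by lia.
Qed.

Lemma tpow_succ n : teq (tpow (Z.succ n)) (inr true :: tpow n).
Proof.
  destruct (Z.le_gt_cases 0 n) as [L|L].
  - rewrite tpow_succ_pos; trivial; apply teq_refl.
  - rewrite (tpow_neg L).
    apply (@teq_app [] [inr true; inr false]); [apply teq_sym, (teq_cancel true)|apply teq_refl].
Qed.

Lemma teq_cons a u v : teq u v -> teq (a :: u) (a :: v).
Proof. apply (@teq_app [a] [a]), teq_refl. Qed.

Lemma tpow_pred n : teq (tpow (Z.pred n)) (inr false :: tpow n).
Proof.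
  apply teq_trans with ([inr false; inr true] ++ tpow (Z.pred n)).
  - apply (@teq_app []); [apply teq_sym, (teq_cancel false)|apply teq_refl].
  - simpl; apply teq_cons, teq_sym; rewrite <- (Z.succ_pred n) at 1; apply tpow_succ.
Qed.

Lemma tpow_add m n : teq (tpow m ++ tpow n) (tpow (m + n)).
Proof.
  induction m as [|m IH|m IH] using Z.peano_ind.
  - apply teq_refl.
  - rewrite Z.add_succ_l; eapply teq_trans; [|apply teq_sym, tpow_succ].
    eapply teq_trans; [apply teq_app; [apply tpow_succ|apply teq_refl]|].
    simpl; now apply teq_cons.
  - rewrite Z.add_pred_l; eapply teq_trans; [|apply teq_sym, tpow_pred].
    eapply teq_trans; [apply teq_app; [apply tpow_pred|apply teq_refl]|].
    simpl; now apply teq_cons.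
Qed.

Lemma tcount_tpow n : tcount (tpow n) = Rabs (IZR n).
Proof.
  rewrite <- abs_IZR, <- Zabs2Nat.id_abs, <- INR_IZR_INZ; unfold tpow.
  generalize (Z.abs_nat n) as k; induction k as [|k IH]; [reflexivity|].
  rewrite S_INR, <- IH; simpl; lra.
Qed.

Lemma tlip_tpow_nil n : tlip (tpow n) [] (Rabs (IZR n)).
Proof.
  rewrite <- tcount_tpow; unfold tpow; generalize (Z.abs_nat n) as k, (0 <=? n)%Z as b.
  intros k b; induction k as [|k IH]; simpl; [apply tlip_refl|].
  apply (@tlip_app [inr b] [] _ []); trivial.
  intros w1 w2 r H; now apply (@fill_delete _ _ H w1 b w2).
Qed.

Lemma tlip_insert z : tlip [] z (defect z).
Proof. intros w1 w2 r H; eapply fill_insert; eauto; simpl in *; lra. Qed.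

(** Write [t^m] as [t^(m-n) t^n] and delete the letters of the first power one by one, each at cost
    1. *)
Lemma tlip_tpow m n : tlip (tpow m) (tpow n) (Rabs (IZR (m - n))).
Proof.
  rewrite <- (Rplus_0_l (Rabs _)); apply tlip_trans with (tpow (m - n) ++ tpow n).
  - replace m with (m - n + n)%Z at 1 by lia; apply tpow_add.
  - rewrite <- (Rplus_0_r (Rabs _)); apply (@tlip_app _ []); [apply tlip_tpow_nil|apply tlip_refl].
Qed.

(** * Filling cost as a lower bound for Graev costs *)

Definition expand (w : word G Zgrp) : tword :=
  flat_map (fun a => match a with inl g => [inl g] | inr n => tpow n end) w.

Lemma expand_app u v : expand (u ++ v) = expand u ++ expand v.
Proof. apply flat_map_app. Qed.

Lemma expand_hat u : teq (expand u) (expand (hat u)).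
Proof.
  apply (@hat_invariant G Zgrp (fun u v => teq (expand u) (expand v))).
  - intros; apply teq_refl.
  - intros; eapply teq_trans; eauto.
  - intros x v w E; apply (teq_app (teq_refl _) E).
  - intros w; apply (@teq_app [inl gone] []); [|apply teq_refl].
    apply teq_gword; auto; simpl; apply gop1x.
  - intros; apply teq_refl.
  - intros a b w; apply (@teq_app [inl a; inl b] [inl (gop a b)]); [|apply teq_refl].
    apply teq_gword; auto; simpl; now rewrite !gopx1.
  - intros a b w; simpl; rewrite app_assoc; apply teq_app; [apply tpow_add|apply teq_refl].
Qed.

Lemma expand_heq u v : heq u v -> teq (expand u) (expand v).
Proof.
  intros E; eapply teq_trans; [apply expand_hat|rewrite E; apply teq_sym, expand_hat].
Qed.

Lemma expand_lip u v : length u = length v -> tlip (expand u) (expand v) (wcost d dZ u v).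
Proof.
  unfold wcost; revert v; induction u as [|x u IH]; intros [|y v] E; try discriminate.
  - apply tlip_refl.
  - injection E as E; simpl; apply tlip_app; auto.
    destruct x as [g|m], y as [h|n]; simpl.
    + generalize (@tlip_gword [inl g] [inl h]); simpl; rewrite !gopx1; auto.
    (* Letters of different factors are at the sum of their distances from the identity, so the
       replacement passes through the empty word. *)
    + apply tlip_trans with [].
      * generalize (@tlip_gword [inl g] []); simpl; rewrite !gopx1; auto.
      * unfold dZ; rewrite Z.sub_0_l, opp_IZR, Rabs_Ropp, <- tcount_tpow.
        eapply tlip_weaken; [apply tlip_insert|unfold defect].
        assert (gprod (tpow n) = gone) as ->.
        { unfold tpow; generalize (Z.abs_nat n) as k; induction k; simpl; auto. }
        rewrite dist_refl; trivial; lra.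
    + apply tlip_trans with [].
      * unfold dZ; rewrite Z.sub_0_r; apply tlip_tpow_nil.
      * generalize (@tlip_gword [] [inl h]); simpl; rewrite !gopx1; auto.
    + apply tlip_tpow.
Qed.

(** The trivial word [v ++ w] has a filling of cost 0, and changing [v] into [u] letter by letter
    raises the cost by at most [wcost]. *)
Lemma fill_graev (u v w : word G Zgrp) : length u = length v -> heq (v ++ w) [] ->
  fill (expand (u ++ w)) (wcost d dZ u v).
Proof.
  intros L E.
  assert (F : fill (expand (v ++ w)) 0).
  { apply expand_heq in E as [_ E]; generalize (E [] [] 0); simpl.
    rewrite !app_nil_r, Rplus_0_r; intros K; apply K, fill_flat; rewrite defect_nil; lra. }
  rewrite expand_app in *; rewrite <- (Rplus_0_l (wcost _ _ _ _)).
  rewrite (wcost_sym Hd dZ_metric).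
  apply (expand_lip _ _ (eq_sym L) [] (expand w) F).
Qed.
End Filling.

(** * The subgroup generated by G and the conjugate of A *)

Section Subgroup.
Variables (G : Grp) (d : G -> G -> R).
Hypotheses (Hd : is_metric d) (Hinv : two_sided_invariant d).
Variables (A : G -> Prop) (HA : is_subgroup A).
Notation K := (word G (subgrp HA)).
Notation dA := (dsub d (HA := HA)).
Notation emb := (flat_map (conj_emb HA)).
Notation gleK := (gle d dA).
Notation gleF := (gle d dZ).
Notation val := (@proj1_sig G A).

Lemma dsub_metric : is_metric dA.
Proof.
  unfold dsub; split; [|split].
  - intros x y; split; [|intros ->; now apply dist_refl].
    intros E; now apply sub_eq, Hd.
  - intros; now apply dist_sym.
  - intros; now apply dist_tri.
Qed.

Lemma dsub_invariant : two_sided_invariant dA.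
Proof. intros g x y; unfold dsub; apply Hinv. Qed.

Lemma emb_app (u v : K) : emb (u ++ v) = emb u ++ emb v.
Proof. apply flat_map_app. Qed.

Lemma heq_t_tinv (e : Zgrp) (w : word G Zgrp) : heq (inr e :: inr (ginv e) :: w) w.
Proof. apply (@heq_linv_r G Zgrp (inr e)). Qed.

(** The embedding respects the relations: in a product of two conjugates the inner [t^-1 t] cancels,
    and [t 1 t^-1] is trivial. *)
Lemma emb_hat (u : K) : heq (emb u) (emb (hat u)).
Proof.
  apply (@hat_invariant G (subgrp HA) (fun u v => heq (emb u) (emb v))).
  - reflexivity.
  - intros ? ? ?; apply eq_trans.
  - intros x v w E; apply heq_app; [reflexivity|exact E].
  - intros w; apply heq_one_l.
  - intros w; simpl; eapply eq_trans; [apply heq_cons, heq_one_l|apply (heq_t_tinv 1%Z)].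
  - intros a b w; apply heq_inl.
  - intros a b w; simpl.
    apply heq_cons, eq_trans with (hat (inl (val a) :: inl (val b) :: inr (-1)%Z :: emb w : word G Zgrp)).
    + apply heq_cons, (heq_t_tinv (-1)%Z).
    + apply heq_inl.
Qed.

Lemma emb_heq (u v : K) : heq u v -> heq (emb u) (emb v).
Proof. unfold heq; intros E; now rewrite (emb_hat u), (emb_hat v), E. Qed.

Lemma gle_heq_trans (H1 H2 : Grp) (d1 : H1 -> H1 -> R) (d2 : H2 -> H2 -> R) u u' v v' r :
  heq u u' -> heq v v' -> gle d1 d2 u' v' r -> gle d1 d2 u v r.
Proof.
  unfold heq; intros E E' [s (a & b & L & Ea & Eb & ->) Hs].
  eexists; [exists a, b; repeat split; trivial; congruence|trivial].
Qed.

(** Two conjugates are compared by pairing their letters t and [t^-1] with themselves. For mixed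
    letters the path goes through the identity, written both as [1] and as [t 1 t^-1]. *)
Lemma gle_emb_letter x y : gleF (conj_emb HA x) (conj_emb HA y) (ldist d dA x y).
Proof.
  assert (L : forall g h, gleF [inl g] [inl h] (d g h)).
  { intros g h; apply (gle_letter d dZ (inl g) (inl h)). }
  assert (C : forall g h, gleF [inr 1%Z; inl g; inr (-1)%Z] [inr 1%Z; inl h; inr (-1)%Z] (d g h)).
  { intros g h; apply (gle_app_l Hd dZ_metric [inr 1%Z]).
    apply (gle_app_r Hd dZ_metric [inr (-1)%Z] (L g h)). }
  assert (O : heq ([inr 1%Z; inl gone; inr (-1)%Z] : word G Zgrp) [inl gone]).
  { apply eq_trans with (hat ([] : word G Zgrp)); [|apply eq_sym, heq_one_l].
    eapply eq_trans; [apply heq_cons, heq_one_l|apply (heq_t_tinv 1%Z)]. }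
  destruct x as [g|a], y as [h|b]; simpl; trivial.
  - eapply gle_trans; [exact Hd|exact dZ_metric|apply (L g gone)|].
    eapply gle_heq_trans; [apply eq_sym, O|reflexivity|apply C].
  - eapply gle_trans; [exact Hd|exact dZ_metric| |apply (L gone h)].
    eapply gle_heq_trans; [reflexivity|apply eq_sym, O|apply C].
Qed.

Lemma gle_emb (u v : K) r : gleK u v r -> gleF (emb u) (emb v) r.
Proof.
  intros [s (a & b & L & Ea & Eb & ->) Hs].
  apply gle_weaken with (wcost d dA a b); trivial.
  eapply gle_heq_trans; [apply emb_heq, eq_sym, Ea|apply emb_heq, eq_sym, Eb|].
  clear -L Hd; unfold wcost; revert b L; induction a as [|x a IH]; intros [|y b] L; try discriminate.
  - simpl; now apply gle_heq; auto using dZ_metric.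
  - injection L as L.
    apply (@gle_app _ _ _ _ (conj_emb HA x) (conj_emb HA y)); [apply gle_emb_letter|auto].
Qed.

(* [parse h w u h']: reading w from height h to height h', where t raises the
   height from 0 ([false]) to 1 ([true]), all letters of G met at height 1 lie
   in A, and u spells the element of G * tAt^-1 with the letters met at
   height 1 taken in tAt^-1. *)
Inductive parse : bool -> tword G -> K -> bool -> Prop :=
| parse_nil h : parse h [] [] h
| parse_g g w u h : parse false w u h -> parse false (inl g :: w) (inl g :: u) h
| parse_a (a : subgrp HA) w u h : parse true w u h -> parse true (inl (val a) :: w) (inr a :: u) h
| parse_t k w u h : parse (negb k) w u h -> parse k (inr (negb k) :: w) u h.

Lemma parse_app_inv w1 w2 h u h' : parse h (w1 ++ w2) u h' ->
  exists k u1 u2, u = u1 ++ u2 /\ parse h w1 u1 k /\ parse k w2 u2 h'.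
Proof.
  revert h u; induction w1 as [|x w1 IH]; simpl; intros h u P.
  - exists h, [], u; repeat split; trivial; constructor.
  - inversion P; subst;
      match goal with Q : parse _ (_ ++ _) _ _ |- _ =>
        destruct (IH _ _ Q) as (k' & u1 & u2 & -> & ? & ?) end;
      do 3 eexists; repeat split; try (constructor; eassumption); eauto; reflexivity.
Qed.

Lemma parse_app w1 w2 h k h' u1 u2 :
  parse h w1 u1 k -> parse k w2 u2 h' -> parse h (w1 ++ w2) (u1 ++ u2) h'.
Proof. induction 1; simpl; trivial; intros; constructor; auto. Qed.

Lemma parse_emb (u : K) : parse false (expand (emb u)) u false.
Proof.
  induction u as [|[g|a] u IH]; simpl.
  - constructor.
  - now constructor.
  - apply (@parse_t false), parse_a; now apply (@parse_t true).
Qed.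

Lemma gle_G_nil g : gleK [inl g] [] (d g gone).
Proof.
  apply gle_heq_trans with [inl g] [inl gone]; [reflexivity|apply eq_sym, heq_one_l|].
  apply (gle_letter d dA (inl g) (inl gone)).
Qed.

Lemma gle_A_nil a : gleK [inr a] [] (d (val a) gone).
Proof.
  apply gle_heq_trans with [inr a] [inr gone]; [reflexivity|apply eq_sym, heq_one_r|].
  apply (gle_letter d dA (inr a) (inr gone)).
Qed.

Hypothesis Hdiam : forall a : subgrp HA, d (val a) gone <= 1.

Lemma gle_drop (u v w : K) a r : gleK u (v ++ inr a :: w) r -> gleK u (v ++ w) (r + 1).
Proof.
  intros L; eapply gle_trans; [exact Hd|exact dsub_metric|exact L|].
  apply (gle_app_l Hd dsub_metric), (@gle_app_r _ _ _ _ Hd dsub_metric [inr a] []).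
  eapply gle_weaken; [apply gle_A_nil|apply Hdiam].
Qed.

Lemma gle_merge x (u v w : K) r : gleK u v r -> heq (x :: v) w -> gleK (x :: u) w r.
Proof.
  intros L E; eapply gle_heq_trans; [reflexivity|apply eq_sym, E|].
  now apply (gle_app_l Hd dsub_metric [x]).
Qed.

(* A stretch at height 1 between two letters t^{+-1} is discarded at a cost of
   at most 1 on each side, that is, one half per letter t^{+-1}; only the
   stretches at the two ends are kept. *)
Definition summary (h : bool) (w : tword G) (u : K) (h' : bool) : Prop :=
  match h, h' with
  | false, false => exists g,
      gleK u [inl g] (tcount w / 2) /\ d (gprod w) g <= tcount w / 2
  | true, false => exists (a : subgrp HA) g,
      gleK u [inr a; inl g] ((tcount w - 1) / 2) /\
      d (gprod w) (gop (val a) g) <= (tcount w - 1) / 2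
  | false, true => exists g (a : subgrp HA),
      gleK u [inl g; inr a] ((tcount w - 1) / 2) /\
      d (gprod w) (gop g (val a)) <= (tcount w - 1) / 2
  | true, true =>
      (exists a : subgrp HA, tcount w = 0 /\ gleK u [inr a] 0 /\ gprod w = val a) \/
      (exists (a : subgrp HA) g (b : subgrp HA), gleK u [inr a; inl g; inr b] ((tcount w - 2) / 2) /\
         d (gprod w) (gop (val a) (gop g (val b))) <= (tcount w - 2) / 2)
  end.

Lemma parse_summary h w u h' : parse h w u h' -> summary h w u h'.
Proof.
  induction 1 as [h|g w u h P IH|a w u h P IH|h w u h' P IH].
  - destruct h; simpl.
    + left; exists (gone : subgrp HA); repeat split; trivial.
      apply gle_heq; auto using dsub_metric; apply eq_sym, heq_one_r.
    + exists gone; rewrite dist_refl; trivial; split; [|lra].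
      eapply gle_weaken; [apply gle_heq; auto using dsub_metric; apply eq_sym, heq_one_l|lra].
  - destruct h; simpl in *.
    + destruct IH as (g' & a & L & D); exists (gop g g'), a; split.
      * apply (gle_merge L), heq_inl.
      * now rewrite <- gopA, dist_mul_l.
    + destruct IH as (g' & L & D); exists (gop g g'); split.
      * apply (gle_merge L), heq_inl.
      * now rewrite dist_mul_l.
  - destruct h; simpl in *.
    + destruct IH as [(b & T & L & ->)|(b & g & c & L & D)]; [left|right].
      * exists (gop (a : subgrp HA) b); repeat split; trivial; apply (gle_merge L), heq_inr.
      * exists (gop (a : subgrp HA) b), g, c; split; [apply (gle_merge L), heq_inr|].
        simpl; now rewrite <- gopA, dist_mul_l.
    + destruct IH as (b & g & L & D); exists (gop (a : subgrp HA) b), g; split.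
      * apply (gle_merge L), heq_inr.
      * simpl; now rewrite <- gopA, dist_mul_l.
  - destruct h, h'; simpl in *.
    (* The word starts with [t^-1], so the initial stretch at height 1 is empty and is recorded as
       the identity of A. *)
    + right; destruct IH as (g & a & L & D); exists (gone : subgrp HA), g, a; split.
      * apply gle_heq_trans with u [inl g; inr a]; [reflexivity|apply heq_one_r|].
        eapply gle_weaken; [exact L|lra].
      * simpl; rewrite gop1x; lra.
    + destruct IH as (g & L & D); exists (gone : subgrp HA), g; split.
      * apply gle_heq_trans with u [inl g]; [reflexivity|apply heq_one_r|].
        eapply gle_weaken; [exact L|lra].
      * simpl; rewrite gop1x; lra.
    + destruct IH as [(a & T & L & E)|(a & g & b & L & D)].
      * exists gone, a; rewrite E, gop1x, dist_refl; trivial; split; [|lra].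
        apply gle_heq_trans with u [inr a]; [reflexivity|apply heq_one_l|].
        eapply gle_weaken; [exact L|lra].
      (* The stretch [a] now lies between two letters [t^{+-1}]. Discarding it costs at most 1,
         exactly the growth of the bound from [(tcount w - 2) / 2] to [tcount w / 2]. *)
      * exists g, b; split.
        -- eapply gle_weaken; [apply (@gle_drop _ [] [inl g; inr b] a _ L)|lra].
        -- generalize (dist_tri Hd (gprod w) (gop (val a) (gop g (val b))) (gop g (val b))) (Hdiam a).
           rewrite dist_mul_one_l; trivial; lra.
    + destruct IH as (a & g & L & D); exists g; split.
      * eapply gle_weaken; [apply (@gle_drop _ [] [inl g] a _ L)|lra].
      * generalize (dist_tri Hd (gprod w) (gop (val a) g) g) (Hdiam a).
        rewrite dist_mul_one_l; trivial; lra.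
Qed.

Lemma dist_conj_one a g b : d g gone <= d (gop a (gop g b)) gone + d (gop a b) gone.
Proof.
  assert (E : d g gone = d (gop a (gop g b)) (gop a b)).
  { rewrite <- (gop1x _ b) at 2; now rewrite dist_mul_l, dist_mul_r. }
  rewrite E, (dist_sym Hd (gop a b)); now apply dist_tri.
Qed.

(** Let n be the number of letters [t^{+-1}]. At height 0 the two errors n/2 add up to n. At height
    1, for the summary [a g b], they add up to n-2; one further unit drops the merged letter [ab],
    and one bounds [d(ab,1)] in the estimate of [d(g,1)]. *)
Lemma parse_loop h w u : parse h w u h -> gleK u [] (defect d w).
Proof.
  intros P; apply parse_summary in P; unfold defect; destruct h; simpl in P.
  - destruct P as [(a & T & L & E)|(a & g & b & L & D)].
    + rewrite T, E; eapply gle_weaken; [eapply gle_trans|]; 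
        [exact Hd|exact dsub_metric|exact L|apply gle_A_nil|lra].
    + assert (gleK u [inr a; inr b] ((tcount w - 2) / 2 + d g gone)) as L'.
      { eapply gle_trans; [exact Hd|exact dsub_metric|exact L|].
        apply (gle_app_l Hd dsub_metric [inr a]), (gle_app_r Hd dsub_metric [inr b] (gle_G_nil g)). }
      eapply gle_heq_trans in L'; [|reflexivity|apply eq_sym, heq_inr].
      apply (@gle_drop _ [] []) in L'; eapply gle_weaken; [exact L'|].
      assert (d (gop (val a) (val b)) gone <= 1) by exact (Hdiam (gop (a : subgrp HA) b)).
      generalize (dist_conj_one (val a) g (val b)).
      generalize (dist_tri Hd (gop (val a) (gop g (val b))) (gprod w) gone).
      rewrite (dist_sym Hd _ (gprod w)); lra.
  - destruct P as (g & L & D); eapply gle_weaken; [eapply gle_trans|];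
      [exact Hd|exact dsub_metric|exact L|apply gle_G_nil|].
    generalize (dist_tri Hd g (gprod w) gone); rewrite (dist_sym Hd g (gprod w)); lra.
Qed.

Lemma fill_parse w r : fill d w r -> forall h u, parse h w u h -> gleK u [] r.
Proof.
  induction 1 as [w r H|e v1 y v2 r s H IH Hs]; intros h u P.
  - eapply gle_weaken; [apply (parse_loop P)|trivial].
  - apply parse_app_inv in P as (k & u1 & u2 & -> & P1 & P).
    inversion P as [| | |k' w' u' h' P' Ek Ew Eu Eh]; subst.
    apply parse_app_inv in P' as (k' & uy & u3 & -> & Py & P').
    inversion P' as [| | |k'' w' u' h' P2 Ek Ew Eu Eh]; subst.
    (* The letter before [y] leads to height [e], and the letter after it can only be read at height
       [e]. So [y] is a loop, and the remaining word [v1 ++ v2] still parses. *)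
    assert (k' = negb k) as -> by (destruct k, k'; simpl in *; congruence).
    rewrite Bool.negb_involutive in *.
    eapply gle_weaken; [|exact Hs]; rewrite Rplus_comm; eapply gle_trans;
      [exact Hd|exact dsub_metric| |apply (IH h), (parse_app P1 P2)].
    apply (gle_app_l Hd dsub_metric), (gle_app_r Hd dsub_metric u3 (parse_loop Py)).
Qed.

Lemma gle_of_emb (u v : K) r : gleF (emb u) (emb v) r -> gleK u v r.
Proof.
  intros [s (a & b & L & Ea & Eb & ->) Hs].
  (* It suffices to bound the norm of [u v^-1]: the image of [v^-1] is appended to both words of the
     pair, and afterwards [v] is multiplied back on the right. *)
  assert (F : gleK (u ++ winv v) [] r).
  { apply gle_weaken with (wcost d dZ a b); trivial.
    eapply fill_parse; [|apply parse_emb].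
    assert (E : heq (emb u ++ emb (winv v)) (a ++ emb (winv v))).
    { now apply heq_app. }
    apply (expand_heq Hd Hinv) in E as [_ E].
    generalize (E [] [] (wcost d dZ a b)); simpl; rewrite !app_nil_r, Rplus_0_r, emb_app.
    intros K0; apply K0, fill_graev; trivial.
    apply eq_trans with (hat (emb v ++ emb (winv v))); [now apply heq_app|].
    rewrite <- emb_app; apply (@emb_heq _ []), heq_winv_r. }
  apply (gle_app_r Hd dsub_metric v) in F; eapply gle_heq_trans; [| |exact F]; [|reflexivity].
  rewrite <- app_assoc, <- (app_nil_r u) at 1; apply heq_app; [reflexivity|].
  apply eq_sym, heq_winv_l.
Qed.
End Subgroup.

(** * Comparison of infima and the equivalence *)

Lemma graev_le (H1 H2 K1 K2 : Grp) (d1 : H1 -> H1 -> R) (d2 : H2 -> H2 -> R)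
  (e1 : K1 -> K1 -> R) (e2 : K2 -> K2 -> R) u v u' v' :
  is_metric d1 -> is_metric d2 -> is_metric e1 -> is_metric e2 ->
  (forall r, gle e1 e2 u' v' r -> gle d1 d2 u v r) ->
  graev d1 d2 u v <= graev e1 e2 u' v'.
Proof.
  intros M1 M2 N1 N2 I; apply graev_glb; trivial; intros x Sx.
  destruct (I x) as [y Sy Hy]; [exists x; trivial; lra|].
  apply Rle_trans with y; trivial; now apply graev_glb.
Qed.

Theorem mainTheorem10 (G : Grp) (d : G -> G -> R)
  (Hd : is_metric d) (Hinv : two_sided_invariant d)
  (A : G -> Prop) (HA : is_subgroup A) (HAc : is_closed d A) :
  (forall u v : word G (subgrp HA),
     graev d dZ (flat_map (conj_emb HA) u) (flat_map (conj_emb HA) v)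
     = graev d (dsub d (HA:=HA)) u v)
  <-> diam_le d A 1.
Proof.
  generalize (dsub_metric Hd HA) (dsub_invariant Hinv (HA := HA)) dZ_metric; intros MA IA MZ.
  split.
  - intros E a1 a2 A1 A2.
    (* By left invariance the distance of [a1] and [a2] is that of [a1^-1 a2] from the identity. *)
    set (b := @gop (subgrp HA) (@ginv (subgrp HA) (exist A a1 A1)) (exist A a2 A2)).
    replace (d a1 a2) with (d (proj1_sig b) gone)
      by (simpl; now rewrite dist_sym, <- (gopVx _ a1), dist_mul_l).
    clearbody b; specialize (E [inl (proj1_sig b)] [inr b]).
    generalize (graev_ge_prod Hd MA Hinv IA [inl (proj1_sig b)] [inr b]); rewrite <- E.
    unfold left_prod, right_prod; cbn [fold_right left_part right_part].
    rewrite !gopx1, (dist_sym MA); change (dsub d b gone) with (d (proj1_sig b) gone).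
    assert (graev d dZ (flat_map (conj_emb HA) [inl (proj1_sig b)])
              (flat_map (conj_emb HA) [inr b]) <= 2); [|lra].
    { apply graev_glb; trivial.
      (* The padding letters [t^0] are at distance 1 from t and from [t^-1], and the middle pair
         costs 0, which gives the total 2. *)
      exists [inr 0%Z; inl (proj1_sig b); inr 0%Z], [inr 1%Z; inl (proj1_sig b); inr (-1)%Z].
      repeat split.
      - eapply eq_trans; [apply heq_one_r|apply heq_cons, heq_one_r].
      - unfold wcost, dZ; simpl; rewrite dist_refl, Rabs_left, Rabs_right by (trivial; lra); lra. }
  - intros D u v; apply Rle_antisym; apply graev_le; trivial; intros r.
    + now apply gle_emb.
    + apply gle_of_emb; trivial.
      intros a; apply D; [apply (proj2_sig a)|apply (sg_one HA)].
Qed.
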